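(* Let $r\geq 2$ and let $p_1\ge p_2\ge \dots \ge p_r\geq 2$ be integers. Then $$R^{PM}(p_1, \dots, p_r)=\max\left\{R^{1C}(p_1-3x_1, \dots, p_r-3x_r)+\sum_{i=1}^r x_i\ :\ x_1,\dots,x_r\in\mathbb{Z},\ 0\leq x_i< \frac{p_i}{3} \text{ for all } i\in [r]\right\}.$$
   Context: $[r]=\{1,\dots,r\}$. An $r$-coloring of $K_n$ is an assignment of a color from $[r]$ to each edge of the complete graph $K_n$ (not necessarily proper, and not every color need be used). The order of a graph is its number of vertices. A path-matching is a vertex-disjoint union of paths, each with at least 2 vertices; its order is the number of vertices it spans. A path-matching of color $i$ is a path-matching that is a subgraph of $K_n$ all of whose edges have color $i$. For positive integers $r,p_1,\dots,p_r$, $R^{PM}(p_1,\dots,p_r)$ is the smallest positive integer $n$ such that in every $r$-coloring of the edges of $K_n$ there exists a path-matching of color $i$ and order at least $p_i$ for some $i\in[r]$. A graph is a 1-core if it has minimum degree at least one, i.e. it has no isolated vertices (it need not be connected). A 1-core of color $i$ is a subgraph of $K_n$ that is a 1-core and all of whose edges have color $i$; the largest 1-core of color $i$ thus spans exactly the vertices incident with at least one edge of color $i$. For positive integers $r,p_1,\dots,p_r$ (in any order), $R^{1C}(p_1,\dots,p_r)$ is the smallest positive integer $n$ such that in every $r$-coloring of the edges of $K_n$ there exists a 1-core of color $i$ and order at least $p_i$ for some $i\in[r]$. *)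

(* Defs.v *)
From mathcomp Require Import all_boot.
From mathcomp Require Import boolp.

Set Implicit Arguments.
Unset Strict Implicit.
Unset Printing Implicit Defensive.

Definition edge (n : nat) : finType := {e : {set 'I_n} | #|e| == 2}.

Definition coloring (n r : nat) : finType := {ffun edge n -> 'I_r}.

Definition mono_adj n r (c : coloring n r) (i : 'I_r) : rel 'I_n :=
  fun x y => [exists e : edge n, (val e == [set x; y]) && (c e == i)].

(** A path-matching is the list of its paths, a path being the list of its
    successive vertices. *)

Definition path_matching n r (c : coloring n r) (i : 'I_r)
    (P : seq (seq 'I_n)) : bool :=
  [&& all (fun s => 2 <= size s) P,
      all (sorted (mono_adj c i)) P
    & uniq (flatten P)].

Definition pm_order n (P : seq (seq 'I_n)) : nat := size (flatten P).

Definition PM_arrow r (p : 'I_r -> nat) (n : nat) : Prop :=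
  forall c : coloring n r, exists (i : 'I_r) (P : seq (seq 'I_n)),
    path_matching c i P /\ p i <= pm_order P.

(** The subgraph of K_n with vertex set A and edge set E is a 1-core of
    color i. *)

Definition one_core n r (c : coloring n r) (i : 'I_r)
    (A : {set 'I_n}) (E : {set edge n}) : Prop :=
  [/\ forall e, e \in E -> val e \subset A,
      forall e, e \in E -> c e = i
    & forall x, x \in A -> exists2 e, e \in E & x \in val e].

Definition core_arrow r (p : 'I_r -> nat) (n : nat) : Prop :=
  forall c : coloring n r, exists (i : 'I_r) (A : {set 'I_n}) (E : {set edge n}),
    one_core c i A E /\ p i <= #|A|.

(** Both Ramsey numbers exist: among sufficiently many disjoint edges, some
    color i occurs at least p i times. *)

Section Existence.

Variables (r : nat) (p : 'I_r -> nat).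

Let m := (\sum_i p i).+1.
Let n := m.*2.

Fact left_subproof (k : 'I_m) : k.*2 < n.
Proof. by rewrite ltn_double. Qed.

Fact right_subproof (k : 'I_m) : k.*2.+1 < n.
Proof. by rewrite ltn_Sdouble. Qed.

Let a (k : 'I_m) : 'I_n := Ordinal (left_subproof k).
Let b (k : 'I_m) : 'I_n := Ordinal (right_subproof k).

Fact ab_subproof (k : 'I_m) : #|[set a k; b k]| == 2.
Proof. by rewrite cards2 -val_eqE /= neq_ltn ltnSn. Qed.

Let ab (k : 'I_m) : edge n := exist _ [set a k; b k] (ab_subproof k).

Let ks (c : coloring n r) i := enum [pred k | c (ab k) == i].
Let PM c i := [seq [:: a k; b k] | k <- ks c i].

Lemma PM_mem (s : seq 'I_m) x :
  x \in flatten [seq [:: a k; b k] | k <- s] ->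
  exists2 k, k \in s & x \in [set a k; b k].
Proof.
case/flatten_mapP=> k ks0 xk; exists k => //.
by move: xk; rewrite !inE.
Qed.

Lemma PM_half (s : seq 'I_m) x :
  x \in flatten [seq [:: a k; b k] | k <- s] ->
  exists2 k, k \in s & x./2 = k.
Proof.
case/PM_mem=> k ks0; rewrite !inE => /orP[] /eqP ->; exists k => //=.
  by rewrite doubleK.
by rewrite uphalf_double.
Qed.

Lemma PM_uniq (s : seq 'I_m) :
  uniq s -> uniq (flatten [seq [:: a k; b k] | k <- s]).
Proof.
elim: s => //= k s IH /andP[kNs us].
have H (x : 'I_n) : x./2 = k -> x \notin flatten [seq [:: a k; b k] | k <- s].
  move=> xk; apply/negP => /PM_half[l ls]; rewrite xk => /val_inj kl.
  by rewrite kl ls in kNs.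
rewrite IH // andbT inE negb_or !H /= ?doubleK ?uphalf_double //.
by rewrite andbT -val_eqE /= neq_ltn ltnSn.
Qed.

Lemma PM_size (s : seq 'I_m) :
  size (flatten [seq [:: a k; b k] | k <- s]) = (size s).*2.
Proof. by elim: s => //= k s ->. Qed.

Lemma PM_exists (c : coloring n r) :
  exists i, path_matching c i (PM c i) /\ p i <= pm_order (PM c i).
Proof.
have [i pi] : exists i, p i <= size (ks c i).
  apply/existsP; apply: contraT; rewrite negb_exists => /forallP H.
  have : \sum_i size (ks c i) <= \sum_i p i.
    by apply: leq_sum => i _; rewrite ltnW // ltnNge.
  suff -> : \sum_i size (ks c i) = m by rewrite ltnn.
  rewrite -[RHS]card_ord -sum1_card (partition_big (fun k => c (ab k)) xpredT) //=.
  by apply: eq_bigr => i _; rewrite sum1_card -cardE.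
exists i; split; last first.
  by rewrite /pm_order PM_size (leq_trans pi) // -addnn leq_addr.
rewrite /path_matching PM_uniq ?enum_uniq // andbT.
apply/andP; split; apply/allP => s /mapP[k]; rewrite mem_enum inE => kc -> //=.
by rewrite andbT; apply/existsP; exists (ab k); rewrite kc eqxx.
Qed.

Lemma PM_arrow_exists : exists k, (0 < k) && `[< PM_arrow p k >].
Proof.
exists n; apply/andP; split => //; apply/asboolP => c.
by have [i Pi] := PM_exists c; exists i, (PM c i).
Qed.

Lemma core_arrow_exists : exists k, (0 < k) && `[< core_arrow p k >].
Proof.
exists n; apply/andP; split => //; apply/asboolP => c.
have [i [/and3P[_ _ uP] Pi]] := PM_exists c; exists i.
exists [set x in flatten (PM c i)], [set ab k | k in ks c i]; split; last first.
  by rewrite cardsE (card_uniqP uP).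
split=> [_ /imsetP[k kc ->]|_ /imsetP[k kc ->]|x].
- apply/subsetP => x; rewrite !inE => xk.
  by apply/flatten_mapP; exists k => //; rewrite !inE.
- by move: kc; rewrite mem_enum inE => /eqP.
rewrite inE => /PM_mem[k kc xk]; exists (ab k) => //.
exact: imset_f.
Qed.

End Existence.

(** Only positive values of p are meaningful; p need not be monotone. *)

Definition R_PM r (p : 'I_r -> nat) : nat := ex_minn (PM_arrow_exists p).

Definition R_1C r (p : 'I_r -> nat) : nat := ex_minn (core_arrow_exists p).

(* Main.v *)
(** In each color a minimax theorem for path-matchings applies: every graph has
    a path-matching P and a vertex set S such that at most |P| - 3|S| vertices
    are non-isolated in G - S. If no color i has a path-matching of order p_i,
    deleting all the sets S_i leaves a coloring without 1-cores of order
    p_i - 3|S_i|; conversely, adding x_i vertices joined to everything in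
    color i increases path-matchings of color i by at most 3 x_i.

    For the minimax theorem, assign to as many vertices v as possible a
    neighbour f v so that fibres of f have at most two elements: Hall's theorem
    on V versus V * bool. The assigned vertices split into two sets X and Y on
    which f is injective, and the matchings v -> f v (v in X) and f v -> v
    (v in Y) of the bipartite double cover combine, by Mendelsohn-Dulmage, into
    a partial injection whose domain and image together cover X and Y. With
    minimal domain, it is a disjoint union of paths on 2 or 3 vertices. *)

Require Import Defs.
From mathcomp Require Import all_boot boolp zify.

Set Implicit Arguments.
Unset Strict Implicit.
Unset Printing Implicit Defensive.

(** * Hall's theorem with deficiency *)

Definition nbhd (A B : finType) (N : A -> {set B}) (T : {set A}) : {set B} :=
  \bigcup_(a in T) N a.

Lemma nbhdP (A B : finType) (N : A -> {set B}) (T : {set A}) b :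
  reflect (exists2 a, a \in T & b \in N a) (b \in nbhd N T).
Proof. exact: bigcupP. Qed.

(* Rado's proof: by submodularity of [#|nbhd N T|], one of any two edges at a
   vertex can be deleted without violating the hypothesis. *)
Lemma matching_of_deficiency (A B : finType) (b0 : B) (N : A -> {set B}) d :
  (forall T : {set A}, #|T| <= #|nbhd N T| + d) ->
  exists (W : {set A}) (m : A -> B),
    [/\ {in W, forall a, m a \in N a}, {in W &, injective m}
      & #|A| <= #|W| + d].
Proof.
have [s] := ubnP (\sum_a #|N a|); elim: s N => // s IH N ltNs defN.
have [/forallP N1|] := boolP [forall a, #|N a| <= 1]; last first.
  rewrite negb_forall => /existsP[a]; rewrite -ltnNge => /card_gt1P[y1 [y2]].
  case=> Ny1 Ny2 y12.
  pose del y a' := if a' == a then N a :\ y else N a'.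
  have delS y a' : del y a' \subset N a'.
    by rewrite /del; case: eqP => [->|//]; rewrite subsetDl.
  have del_sum y : y \in N a -> \sum_a' #|del y a'| < s.
    move=> Ny; rewrite -ltnS; apply: leq_trans ltNs.
    rewrite ltnS (bigD1 a) //= [X in _ < X](bigD1 a) //=.
    rewrite -addSn leq_add //; last by apply: leq_sum => a' _; apply: subset_leq_card.
    by rewrite /del eqxx (cardsD1 y (N a)) Ny.
  have IHy y : y \in N a -> (forall T : {set A}, #|T| <= #|nbhd (del y) T| + d) ->
    exists (W : {set A}) (m : A -> B),
      [/\ {in W, forall a, m a \in N a}, {in W &, injective m}
        & #|A| <= #|W| + d].
    move=> Ny /(IH _ (del_sum y Ny))[W [m [mN minj cW]]]; exists W, m; split=> //.
    by move=> a' /mN; apply: (subsetP (delS y a')).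
  have [/forallP|] := boolP [forall T : {set A}, #|T| <= #|nbhd (del y1) T| + d].
    exact: IHy.
  have [/forallP|] := boolP [forall T : {set A}, #|T| <= #|nbhd (del y2) T| + d].
    by move=> h _; exact: IHy h.
  rewrite !negb_forall => /existsP[T2 bad2] /existsP[T1 bad1]; exfalso.
  have aT y (T : {set A}) : ~~ (#|T| <= #|nbhd (del y) T| + d) -> a \in T.
    apply: contraR => aNT; apply: leq_trans (defN T) _; rewrite leq_add2r.
    apply: subset_leq_card; apply/subsetP => b /nbhdP[a' a'T ba'].
    apply/nbhdP; exists a' => //; rewrite /del; case: eqP => // ea.
    by rewrite -ea a'T in aNT.
  have aT1 := aT _ _ bad1; have aT2 := aT _ _ bad2.
  set M1 := nbhd (del y1) T1 in bad1; set M2 := nbhd (del y2) T2 in bad2.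
  (* Since [y1 != y2], what [a] loses in [M1] it keeps in [M2], so the union still contains all of
     [N a]. *)
  have sU : nbhd N (T1 :|: T2) \subset M1 :|: M2.
    apply/subsetP => b /nbhdP[a' a'T ba']; rewrite inE.
    have [ea|na] := eqVneq a' a.
      rewrite ea in ba'; have [eb|nb] := eqVneq b y1.
        apply/orP; right; apply/nbhdP; exists a => //.
        by rewrite /del eqxx !inE ba' eb y12.
      apply/orP; left; apply/nbhdP; exists a => //.
      by rewrite /del eqxx !inE ba' nb.
    move: a'T; rewrite inE => /orP[] a'T; apply/orP; [left|right];
      by apply/nbhdP; exists a' => //; rewrite /del (negPf na).
  have sI : nbhd N ((T1 :&: T2) :\ a) \subset M1 :&: M2.
    apply/subsetP => b /nbhdP[a']; rewrite !inE => /and3P[na a1 a2] ba'.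
    by apply/andP; split; apply/nbhdP; exists a' => //; rewrite /del (negPf na).
  (* The two violations give a total deficit of at least 2, whereas dropping [a] from the
     intersection accounts for only 1. *)
  have := subset_leq_card sU; have := subset_leq_card sI.
  have := defN (T1 :|: T2); have := defN ((T1 :&: T2) :\ a).
  have := cardsUI T1 T2; have := cardsUI M1 M2.
  have := cardsD1 a (T1 :&: T2); rewrite inE aT1 aT2 /=.
  lia.
pose m a := odflt b0 [pick b in N a].
have mE a b : b \in N a -> N a = [set m a].
  move=> ba; have /cards1P[b' eN] : #|N a| == 1.
    by rewrite eqn_leq N1; apply/card_gt0P; exists b.
  rewrite {1}eN /m; case: pickP => [b''|/(_ b)]; last by rewrite ba.
  by rewrite eN inE => /eqP ->.
(* The inner [pick] depends only on [N a], so [W] holds exactly one representative of each nonempty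
   neighbourhood. *)
pose W := [set a | (N a != set0) && ([pick a' | N a' == N a] == Some a)].
have WN a : a \in W -> N a = [set m a].
  by rewrite inE => /andP[/set0Pn[b /mE]].
exists W, m; split=> [a /WN ->|a a' aW a'W em|]; first by rewrite inE.
  have eN : N a = N a' by rewrite (WN _ aW) (WN _ a'W) em.
  move: aW a'W; rewrite !inE => /andP[_ /eqP pa] /andP[_ /eqP pa'].
  by move: pa; rewrite eN pa' => -[].
rewrite -cardsT; apply: leq_trans (defN setT) _; rewrite leq_add2r.
apply: leq_trans (leq_imset_card m W); apply: subset_leq_card.
apply/subsetP => b /nbhdP[a _ ba].
have [a' pa'] : exists a', [pick a' | N a' == N a] = Some a'.
  by case: pickP => [a'|/(_ a)]; [exists a'|rewrite eqxx].
have eN : N a' = N a by move: pa'; case: pickP => // a'' /eqP ea [<-].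
have a'W : a' \in W.
  rewrite inE eN pa' eqxx andbT; by apply/set0Pn; exists b.
apply/imsetP; exists a' => //; apply/set1P.
by rewrite -(WN _ a'W) eN.
Qed.

(** With [d] the largest deficiency, a set [T] attaining it certifies that the matching on [W] is
    maximum. *)
Lemma deficient_hall (A B : finType) (b0 : B) (N : A -> {set B}) :
  exists (T W : {set A}) (m : A -> B),
    [/\ {in W, forall a, m a \in N a}, {in W &, injective m}
      & #|A| + #|nbhd N T| <= #|W| + #|T|].
Proof.
pose T := [arg max_(T > set0 : {set A}) (#|T| - #|nbhd N T|)].
have maxT (T' : {set A}) : #|T'| - #|nbhd N T'| <= #|T| - #|nbhd N T|.
  by rewrite /T; case: arg_maxnP => // T0 _; apply.
have [|W [m [mN minj cW]]] :=
  @matching_of_deficiency _ _ b0 N (#|T| - #|nbhd N T|).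
- by move=> T'; have := maxT T'; lia.
(* Subtraction is truncated: a maximizer with more neighbours than elements only records deficiency
   0, and the empty set replaces it. *)
have [le|lt] := leqP #|nbhd N T| #|T|; [exists T|exists set0]; exists W, m; split=> //.
  by move: cW le; lia.
have -> : nbhd N set0 = set0 by rewrite /nbhd big_set0.
by move: cW lt; rewrite !cards0; lia.
Qed.

(** * Path-matchings from injections, and the minimax theorem *)

(* Mendelsohn-Dulmage: [v -> f v] is used on the fixpoint Z, and [f y -> y] on
   the elements y of Y that f does not reach from Z. *)
Lemma injections_amalgamate (V : finType) (f : V -> V) (X Y : {set V}) :
  {in X &, injective f} -> {in Y &, injective f} ->
  exists (D : {set V}) (g : V -> V),
    [/\ {in D &, injective g},
        {in D, forall v, v \in X /\ g v = f v \/ g v \in Y /\ v = f (g v)},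
        X \subset D & Y \subset g @: D].
Proof.
move=> fX fY.
pose F (Z : {set V}) := X :\: f @: (Y :\: f @: Z).
have Fmono : {homo F : Z1 Z2 / Z1 \subset Z2}.
  by move=> Z1 Z2 s12; rewrite setDS // imsetS // setDS // imsetS.
pose Z := fixset F; have ZE : Z = F Z by rewrite /Z fixsetK.
have sZX : Z \subset X by rewrite ZE subsetDl.
pose H := Y :\: f @: Z.
have sHY : H \subset Y by rewrite subsetDl.
pose g v := if v \in Z then f v else odflt v [pick y in H | f y == v].
have gZ v : v \in Z -> g v = f v by rewrite /g => ->.
have HNZ y : y \in H -> f y \notin Z.
  by move=> yH; rewrite ZE inE imset_f.
have gH y : y \in H -> g (f y) = y.
  move=> yH; rewrite /g (negPf (HNZ y yH)).
  case: pickP => [y' /andP[y'H /eqP /fY]|/(_ y)]; last by rewrite yH eqxx.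
  by apply; apply: (subsetP sHY).
exists (Z :|: f @: H), g; split.
- move=> u v; rewrite !inE => /orP[uZ|/imsetP[u' u'H ->]] /orP[vZ|/imsetP[v' v'H ->]].
  + by rewrite !gZ //; apply: fX; apply: (subsetP sZX).
  + rewrite gZ // gH // => e; move: v'H; rewrite -e inE imset_f //.
  + rewrite (gZ v) // gH // => e; move: u'H; rewrite e inE imset_f //.
  + by rewrite !gH // => ->.
- move=> v; rewrite inE => /orP[vZ|/imsetP[v' v'H ->]]; [left|right].
    by rewrite gZ // (subsetP sZX).
  by rewrite gH // (subsetP sHY).
- apply/subsetP => v vX; rewrite inE; have [//|vNZ] := boolP (v \in Z).
  by move: vNZ; rewrite {1}ZE inE vX andbT negbK.
- apply/subsetP => y yY; have [yZ|yNZ] := boolP (y \in f @: Z).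
    case/imsetP: yZ => z zZ ->; rewrite -gZ //; apply: imset_f.
    by rewrite inE zZ.
  have yH : y \in H by rewrite inE yNZ.
  by rewrite -(gH y yH); apply: imset_f; rewrite inE imset_f ?orbT.
Qed.

(** Choose [E] minimal with this union. If [x] in [E] were an image and [g x] were in [E], then [x]
    could be dropped: it stays covered as the image of another vertex, there being no fixed points,
    and [g x] as a member of [E]. This excludes cycles and chains of three arrows. *)
Lemma thin_injection (V : finType) (D : {set V}) (g : V -> V) :
  {in D, forall x, g x != x} ->
  exists E : {set V},
    [/\ E \subset D, E :|: g @: E = D :|: g @: D
      & {in E, forall x, x \in g @: E -> g x \notin E}].
Proof.
move=> gD.
pose ok (E : {set V}) := (E \subset D) && (E :|: g @: E == D :|: g @: D).
have [E /minsetP[/andP[sED /eqP EU] minE] _] : {E | minset ok E & E \subset D}.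
  by apply: minset_exists; rewrite /ok subxx eqxx.
exists E; split=> // x xE xgE; apply/negP => gxE.
have gxx : g x != x by apply: gD; apply: (subsetP sED).
suff /minE : ok (E :\ x) by move/(_ (subD1set _ _)) => eE; move: xE; rewrite -eE !inE eqxx.
rewrite /ok (subset_trans (subD1set _ _) sED) -EU eqEsubset setUSS ?subD1set ?imsetS ?subD1set //=.
apply/subsetP => u; rewrite inE => /orP[uE|/imsetP[v vE ->]].
  have [->|ux] := eqVneq u x; last by rewrite !inE ux uE.
  case/imsetP: xgE => v vE xv; rewrite inE xv imset_f ?orbT // !inE vE andbT.
  by apply: contra gxx => /eqP vx; rewrite xv -!vx.
have [->|vx] := eqVneq v x; first by rewrite !inE gxE gxx.
by rewrite inE imset_f ?orbT // !inE vx.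
Qed.

Lemma flatten_map_uniq (T U : eqType) (h : T -> seq U) (s : U -> T) l :
  uniq l -> {in l, forall x, uniq (h x)} ->
  {in l, forall x, {in h x, forall u, s u = x}} ->
  uniq (flatten (map h l)).
Proof.
elim: l => //= x l IH /andP[xNl ul] uh sh.
rewrite cat_uniq uh ?mem_head //=; apply/andP; split; last first.
  by apply: IH => // y yl; [apply: uh|apply: sh]; rewrite inE yl orbT.
apply/hasPn => u /flatten_mapP[y yl uy]; apply: contra xNl => ux.
by rewrite -(sh x (mem_head _ _) u ux) (sh y _ u uy) // inE yl orbT.
Qed.

Lemma paths_of_injection (V : finType) (e : rel V) (D : {set V}) (g : V -> V) :
  {in D &, injective g} -> {in D, forall x, e x (g x)} -> irreflexive e ->
  exists P : seq (seq V),
    [/\ all (fun s => 1 < size s) P, all (sorted e) P, uniq (flatten P)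
      & #|D :|: g @: D| <= size (flatten P)].
Proof.
move=> gD eD eirr.
have eN x y : e x y -> x != y by apply: contraTneq => ->; rewrite eirr.
have [E [sED <- thin]] : exists E : {set V},
    [/\ E \subset D, E :|: g @: E = D :|: g @: D
      & {in E, forall x, x \in g @: E -> g x \notin E}].
  by apply: thin_injection => x xD; rewrite eq_sym eN ?eD.
have gE : {in E &, injective g}.
  by move=> u v uE vE; apply: gD; apply: (subsetP sED).
have eE : {in E, forall x, e x (g x)} by move=> u uE; apply/eD/(subsetP sED).
pose S := E :\: g @: E.
pose path_from x := [:: x, g x & if g x \in E then [:: g (g x)] else [::]].
pose pre u := odflt u [pick x in E | g x == u].
have preg x : x \in E -> pre (g x) = x.
  move=> xE; rewrite /pre; case: pickP => [y /andP[yE /eqP /gE]|/(_ x)].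
    exact.
  by rewrite xE eqxx.
(* Paths are told apart by their first vertex, found by stepping back along [g] at most twice. *)
pose start u := if u \in S then u else if pre u \in S then pre u else pre (pre u).
have gNS x : x \in E -> g x \notin S by move=> xE; rewrite inE imset_f.
have SE x : x \in S -> x \in E by rewrite inE => /andP[].
have startE x : x \in S -> {in path_from x, forall u, start u = x}.
  move=> xS u; have xE := SE _ xS.
  have sgx : start (g x) = x by rewrite /start (negPf (gNS _ xE)) preg // xS.
  rewrite !inE => /or3P[/eqP->|/eqP->//|]; first by rewrite /start xS.
  case: ifP => // gxE; rewrite inE => /eqP->.
  by rewrite /start (negPf (gNS _ gxE)) preg // (negPf (gNS _ xE)) preg.
exists (map path_from (enum S)); split.
- by apply/allP => s /mapP[x _ ->].
- apply/allP => s /mapP[x]; rewrite mem_enum => /SE xE -> /=.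
  by rewrite eE //=; case: ifP => //= gxE; rewrite eE.
- apply: (flatten_map_uniq (s := start)); rewrite ?enum_uniq // => x; rewrite mem_enum => xS.
    have xE := SE _ xS; have xgx := eN _ _ (eE _ xE).
    rewrite /path_from; case: ifP => gxE /=; rewrite !inE ?negb_or xgx //=.
    rewrite (eN _ _ (eE _ gxE)) !andbT.
    by apply: contraTneq xS => ->; exact: gNS.
  exact: startE.
apply: leq_trans (card_size _); apply: subset_leq_card; apply/subsetP.
(* By thinness a predecessor in [E] of [x] in [E] lies in [S], so [x] is first or second on its
   path. *)
have cov1 x : x \in E -> x \in flatten (map path_from (enum S)).
  move=> xE; have [/imsetP[y yE xy]|xNg] := boolP (x \in g @: E).
    apply/flatten_mapP; exists y; last by rewrite xy !inE eqxx orbT.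
    rewrite mem_enum inE yE andbT; apply/negP => /(thin _ yE).
    by rewrite -xy xE.
  apply/flatten_mapP; exists x; last by rewrite !inE eqxx.
  by rewrite mem_enum inE xE xNg.
move=> u; rewrite inE => /orP[/cov1//|/imsetP[x xE ->]].
have [/imsetP[y yE xy]|xNg] := boolP (x \in g @: E); apply/flatten_mapP.
  exists y; last by rewrite !inE -xy xE inE eqxx !orbT.
  rewrite mem_enum inE yE andbT; apply/negP => /(thin _ yE).
  by rewrite -xy xE.
exists x; last by rewrite !inE eqxx orbT.
by rewrite mem_enum inE xE xNg.
Qed.

Lemma path_matching_minimax (V : finType) (e : rel V) :
  symmetric e -> irreflexive e ->
  exists (P : seq (seq V)) (S : {set V}),
    [/\ all (fun s => 1 < size s) P, all (sorted e) P, uniq (flatten P)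
      & #|[set x in ~: S | [exists y in ~: S, e x y]]| + 3 * #|S|
        <= size (flatten P)].
Proof.
(* The empty graph is set aside because Hall's theorem is applied with a default vertex. *)
move=> esym eirr; have [/eqP/card0_eq V0|] := boolP (#|V| == 0).
  exists [::], set0; split=> //=; rewrite cards0 muln0 addn0 leqn0.
  by apply/eqP/eq_card0 => x; have := V0 x; rewrite inE.
rewrite -lt0n => /card_gt0P[v0 _].
pose N v := [set wb : V * bool | e v wb.1].
have [T [W [m [mN minj cW]]]] := deficient_hall (v0, true) N.
pose f v := (m v).1; pose X := [set v in W | (m v).2].
have ef : {in W, forall v, e v (f v)} by move=> v /mN; rewrite inE.
have fX : {in X &, injective f}.
  move=> u v; rewrite !inE => /andP[uW mu] /andP[vW mv] fuv; apply: minj => //.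
  by apply: injective_projections; rewrite // mu mv.
have fY : {in W :\: X &, injective f}.
  move=> u v; rewrite !inE => /andP[mu uW] /andP[mv vW] fuv; apply: minj => //.
  by apply: injective_projections; move: mu mv; rewrite uW vW //= => /negPf -> /negPf ->.
have [D [g [gD gf sX sY]]] := injections_amalgamate fX fY.
have [|//|P [P2 Pe uP cP]] := @paths_of_injection _ e D g gD.
  move=> v /gf[[vX ->]|[gvY {1}->]].
    by apply: ef; move: vX; rewrite inE => /andP[].
  by rewrite esym; apply: ef; move: gvY; rewrite inE => /andP[].
have {}cP : #|W| <= size (flatten P).
  apply: leq_trans cP; apply: subset_leq_card; rewrite -(setID W X).
  by rewrite setUSS // (subset_trans _ sX) // subsetIr.
pose NT := [set w | [exists v in T, e v w]].
have cNT : #|nbhd N T| = #|NT|.*2.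
  have -> : nbhd N T = setX NT [set: bool].
    apply/setP => -[w b]; rewrite !inE andbT; apply/nbhdP/exists_inP.
      by case=> v vT; rewrite inE /=; exists v.
    by case=> v vT vw; exists v; rewrite ?inE.
  by rewrite cardsX cardsT card_bool muln2.
(* [T0] is independent, so its neighbourhood [S] avoids [T]. Passing from [T] and [NT] to [T0] and
   [S] removes [T :&: NT] from both, hence cannot increase twice the size of the neighbourhood minus
   the size of the set. *)
pose T0 := T :\: NT; pose S := [set w | [exists v in T0, e v w]].
have sS : S \subset NT :\: T.
  apply/subsetP => w; rewrite !inE => /exists_inP[v]; rewrite inE => /andP[vN vT] vw.
  apply/andP; split; last by apply/exists_inP; exists v.
  apply: contra vN => wT; rewrite inE; apply/exists_inP; exists w => //.
  by rewrite esym.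
exists P, S; split=> //.
set U := [set x in ~: S | _].
have sU : U \subset ~: (S :|: T0).
  apply/subsetP => x; rewrite !inE negb_or => /andP[xS /exists_inP[y yS xy]].
  rewrite xS /=; apply: contraL yS => xT0; rewrite !inE negbK.
  by apply/exists_inP; exists x; rewrite // !inE.
have dST : S :&: T0 = set0.
  apply/eqP; rewrite setI_eq0 disjoints_subset; apply: subset_trans sS _.
  by apply/subsetP => x; rewrite !inE => /andP[_ ->].
(* Deleting [S] isolates [T0], so the left side is at most [#|V| + 2 * #|S| - #|T0|], which is at
   most [#|W|] by the choice of [T]. *)
have := subset_leq_card sU; have := cardsC (S :|: T0); have := cardsUI S T0.
have := subset_leq_card sS; have := cardsID NT T; have := cardsID T NT.
rewrite dST cards0 (setIC NT T) -/T0; move: cW cP; rewrite cNT.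
by rewrite -muln2; lia.
Qed.

(** * Colorings as symmetric functions on finite types *)

(** Arbitrary finite types allow passing to subsets of the vertices and adding new ones. Values of
    [k] on the diagonal are ignored. *)
Definition color_rel (V : finType) r (k : V -> V -> 'I_r) i : rel V :=
  fun x y => (x != y) && (k x y == i).

Definition pm_unavoidable r (p : 'I_r -> nat) (V : finType) : Prop :=
  forall k : V -> V -> 'I_r, (forall x y, k x y = k y x) ->
  exists (i : 'I_r) (P : seq (seq V)),
    [/\ all (fun s => 1 < size s) P, all (sorted (color_rel k i)) P,
        uniq (flatten P) & p i <= size (flatten P)].

(** The vertex set of the largest 1-core of color [i]. *)
Definition color_support (V : finType) r (k : V -> V -> 'I_r) i : {set V} :=
  [set x | [exists y, color_rel k i x y]].

Definition core_unavoidable r (p : 'I_r -> nat) (V : finType) : Prop :=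
  forall k : V -> V -> 'I_r, (forall x y, k x y = k y x) ->
  exists i : 'I_r, p i <= #|color_support k i|.

Lemma coloring_of_fun n r (k : 'I_n -> 'I_n -> 'I_r) :
  (forall x y, k x y = k y x) ->
  exists c : coloring n r, forall i, mono_adj c i =2 color_rel k i.
Proof.
move=> ksym.
have /fin_all_exists[/= f fE] (e : edge n) : exists j : 'I_r,
    forall x y, val e = [set x; y] -> k x y = j.
  have /cards2P[a [b [ab eab]]] := valP e; exists (k a b) => x y; rewrite eab => exy.
  have xy : x != y.
    by have := cards2 x y; rewrite -exy cards2 ab; case: (x != y).
  have := set21 x y; have := set22 x y; rewrite -exy !inE.
  do 2![case/orP=> /eqP ?]; subst=> //; by rewrite eqxx in xy.
exists (finfun f) => i x y; rewrite /mono_adj /color_rel.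
apply/existsP/andP => [[e /andP[/eqP exy]]|[xy kxy]].
  rewrite ffunE -(fE _ _ _ exy) => ->; split=> //.
  by have /eqP := valP e; rewrite exy cards2; case: (x != y).
have c2 : #|[set x; y]| == 2 by rewrite cards2 xy.
exists (Sub [set x; y] c2); rewrite eqxx ffunE.
by rewrite -(fE (Sub [set x; y] c2) x y).
Qed.

Lemma fun_of_coloring n r (i0 : 'I_r) (c : coloring n r) :
  exists2 k : 'I_n -> 'I_n -> 'I_r, (forall x y, k x y = k y x) &
    forall i, mono_adj c i =2 color_rel k i.
Proof.
(* The default [i0] is taken only on the diagonal, where [[set x; y]] is not an edge. *)
exists (fun x y => if insub [set x; y] is Some e then c (e : edge n) else i0).
  by move=> x y; rewrite setUC.
move=> i x y; rewrite /mono_adj /color_rel.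
apply/existsP/andP => [[e /andP[/eqP exy]]|[xy]].
  move=> /eqP ce; split.
    by have /eqP := valP e; rewrite exy cards2; case: (x != y).
  by rewrite -exy valK ce.
case: insubP => [e _ eE|]; last by rewrite cards2 xy.
  by move=> ce; exists e; rewrite eE eqxx.
Qed.

Lemma injection_of_card_le (V W : finType) :
  #|V| <= #|W| -> exists f : V -> W, injective f.
Proof.
move=> le; exists (fun v => enum_val (widen_ord le (enum_rank v))).
by move=> u v /enum_val_inj /(congr1 val) /= /val_inj /enum_rank_inj.
Qed.

Lemma color_rel_comp (V W : finType) r (f : V -> W) (k : W -> W -> 'I_r) i x y :
  injective f -> color_rel (fun x y => k (f x) (f y)) i x y = color_rel k i (f x) (f y).
Proof. by move=> finj; rewrite /color_rel (inj_eq finj). Qed.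

Lemma pm_unavoidable_le r (p : 'I_r -> nat) (V W : finType) :
  #|V| <= #|W| -> pm_unavoidable p V -> pm_unavoidable p W.
Proof.
case/injection_of_card_le=> f finj pmV k ksym.
have [//|i [P [P2 Pi uP pP]]] := pmV (fun x y => k (f x) (f y)).
exists i, (map (map f) P); split; last by rewrite -map_flatten size_map.
- by rewrite all_map; apply: sub_all P2 => s /=; rewrite size_map.
- rewrite all_map; apply: sub_all Pi => s /=; rewrite sorted_map.
  by apply: sub_sorted => x y; rewrite color_rel_comp.
- by rewrite -map_flatten map_inj_uniq.
Qed.

Lemma core_unavoidable_le r (p : 'I_r -> nat) (V W : finType) :
  #|V| <= #|W| -> core_unavoidable p V -> core_unavoidable p W.
Proof.
case/injection_of_card_le=> f finj coreV k ksym.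
have [//|i pi] := coreV (fun x y => k (f x) (f y)).
exists i; apply: leq_trans pi _; rewrite -(card_imset _ finj).
apply: subset_leq_card; apply/subsetP => _ /imsetP[x + ->]; rewrite !inE.
by case/existsP=> y; rewrite color_rel_comp // => xy; apply/existsP; exists (f y).
Qed.

Lemma PM_arrowP r (i0 : 'I_r) (p : 'I_r -> nat) n :
  PM_arrow p n <-> pm_unavoidable p 'I_n.
Proof.
split=> [pm k ksym|pm c].
  have [c cE] := coloring_of_fun ksym; have [i [P [/and3P[P2 Pi uP] pP]]] := pm c.
  exists i, P; split=> //; apply: sub_all Pi => s.
  by apply: sub_sorted => x y; rewrite cE.
have [k ksym cE] := fun_of_coloring i0 c; have [i [P [P2 Pi uP pP]]] := pm k ksym.
exists i, P; split=> //; apply/and3P; split=> //; apply: sub_all Pi => s.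
by apply: sub_sorted => x y; rewrite cE.
Qed.

Lemma core_arrowP r (i0 : 'I_r) (p : 'I_r -> nat) n :
  core_arrow p n <-> core_unavoidable p 'I_n.
Proof.
split=> [core k ksym|core c].
  have [c cE] := coloring_of_fun ksym.
  have [i [A [E [[_ Ei EA] pA]]]] := core c.
  exists i; apply: leq_trans pA _; apply: subset_leq_card; apply/subsetP => x.
  case/EA=> e /Ei ce; have /cards2P[a [b [ab eab]]] := valP e; rewrite eab inE.
  have adj : color_rel k i a b.
    by rewrite -cE; apply/existsP; exists e; rewrite eab ce !eqxx.
  rewrite !inE => /orP[]/eqP->; apply/existsP; [by exists b|exists a].
  by move: adj; rewrite /color_rel eq_sym ksym.
have [k ksym cE] := fun_of_coloring i0 c; have [i pi] := core k ksym.
exists i, (color_support k i), [set e | c e == i]; split=> //; split=> [e|e|x].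
- rewrite inE => /eqP ce; have /cards2P[a [b [ab eab]]] := valP e.
  have adj : color_rel k i a b.
    by rewrite -cE; apply/existsP; exists e; rewrite eab ce !eqxx.
  rewrite eab; apply/subsetP => x.
  rewrite !inE => /orP[]/eqP->; apply/existsP; [by exists b|exists a].
  by move: adj; rewrite /color_rel eq_sym ksym.
- by rewrite inE => /eqP.
rewrite inE => /existsP[y]; rewrite -cE => /existsP[e /andP[/eqP eE ce]].
by exists e; rewrite ?inE // eE set21.
Qed.

(** * Path-matchings when every edge meets X or lies inside K *)

(** Each vertex outside [X] and [K], except possibly the first of the path, is charged to its
    predecessor, which must lie in [X]. *)
Lemma path_count_outside_le (V : Type) (e : rel V) (K X : pred V) y s :
  (forall u v, e u v -> [|| X u, X v | K u && K v]) ->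
  path e y s ->
  count (predC (predU X K)) (y :: s)
    <= count X (y :: s) + ~~ (X y || K y).
Proof.
move=> eXK; elim: s y => [|z s IH] y /=; first by rewrite addnC addn0 leq_add2r.
case/andP=> /eXK yz /IH /=.
by move: yz; case: (X y); case: (X z); case: (K y); case: (K z) => //=; lia.
Qed.

(* The neighbours of a vertex outside K lie in X, and a vertex of X has at most
   two neighbours on a path. *)
Lemma count_outside_le (V : Type) (e : rel V) (K X : pred V) s :
  (forall u v, e u v -> [|| X u, X v | K u && K v]) ->
  1 < size s -> sorted e s ->
  count (predC (predU X K)) s <= 2 * count X s.
Proof.
move=> eXK; case: s => [|y [|z s]] //= _ /andP[yz zs].
(* If the first vertex [y] is outside, its successor [z] is in [X] and pays for it. *)
have := path_count_outside_le eXK zs; have := eXK _ _ yz => /=.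
by case: (X y); case: (X z); case: (K y); case: (K z) => //=; lia.
Qed.

(** The factor 3 counts each vertex of [X] itself and at most two outside vertices charged to it. *)
Lemma path_matching_size_le (V : finType) (e : rel V) (K X : {set V})
    (P : seq (seq V)) :
  (forall u v, e u v -> [|| u \in X, v \in X | (u \in K) && (v \in K)]) ->
  all (fun s => 1 < size s) P -> all (sorted e) P -> uniq (flatten P) ->
  size (flatten P) <= #|K| + 3 * #|X|.
Proof.
move=> eXK P2 Pe uP.
pose good := predU (mem X) (mem K).
have bad : count (predC good) (flatten P) <= 2 * count (mem X) (flatten P).
  elim: P P2 Pe {uP} => //= s P IH /andP[s2 P2] /andP[se Pe].
  rewrite !count_cat mulnDr leq_add ?IH //.
  exact: (count_outside_le eXK).
have cnt (A : {set V}) : count (mem A) (flatten P) <= #|A|.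
  rewrite -size_filter -(card_uniqP (filter_uniq _ uP)).
  by apply: subset_leq_card; apply/subsetP => x; rewrite mem_filter => /andP[].
have := count_predC good (flatten P).
have := count_predUI (mem X) (mem K) (flatten P); rewrite -/good.
have := cnt X; have := cnt K; lia.
Qed.

Lemma color_rel_sym (V : finType) r (k : V -> V -> 'I_r) i :
  (forall x y, k x y = k y x) -> symmetric (color_rel k i).
Proof. by move=> ksym x y; rewrite /color_rel eq_sym ksym. Qed.

Lemma color_rel_irrefl (V : finType) r (k : V -> V -> 'I_r) i :
  irreflexive (color_rel k i).
Proof. by move=> x; rewrite /color_rel eqxx. Qed.

(** * The two inequalities and the theorem *)

Lemma pm_unavoidable_of_core r (p : 'I_r -> nat) (V : finType) :
  (forall x : 'I_r -> nat, (forall i, 3 * x i < p i) ->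
     exists2 U : finType, core_unavoidable (fun i => p i - 3 * x i) U &
       #|U| + \sum_i x i <= #|V|) ->
  pm_unavoidable p V.
Proof.
move=> core k ksym; apply: contrapT => /forallNP noP.
have /fin_all_exists[S SE] i : exists S : {set V},
    #|[set x in ~: S | [exists y in ~: S, color_rel k i x y]]| + 3 * #|S| < p i.
  have [P [S [P2 Pi uP cP]]] :=
    path_matching_minimax (@color_rel_sym _ _ k i ksym) (color_rel_irrefl k i).
  exists S; apply: leq_ltn_trans cP _; rewrite ltnNge; apply/negP => pP.
  by apply: (noP i); exists P.
have [i|U coreU cU] := core (fun i => #|S i|); first by have := SE i; lia.
(* The [S i] may overlap, which only enlarges [rest]; it has at least [#|U|] vertices. *)
pose rest := ~: \bigcup_i S i.
have cS : #|\bigcup_i S i| <= \sum_i #|S i|.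
  elim/big_rec2: _ => [|i m A _ Am]; first by rewrite cards0.
  by apply: leq_trans (leq_card_setU _ _) _; rewrite leq_add2l.
have leU : #|U| <= #|{: {x | x \in rest}}|.
  by rewrite card_sig; have := cardsC (\bigcup_i S i); rewrite -/rest cardsE; lia.
have [//|i pi] := core_unavoidable_le leU coreU
  (k := fun x y => k (val x) (val y)).
(* A vertex of [rest] with an edge of color [i] inside [rest] is not isolated in color [i] after
   deleting [S i], and by [SE] there are fewer than [p i - 3 * #|S i|] such vertices. *)
have := SE i; suff : p i - 3 * #|S i|
    <= #|[set x in ~: S i | [exists y in ~: S i, color_rel k i x y]]| by lia.
apply: leq_trans pi _; rewrite -(card_imset _ val_inj).
have restS (x : {x | x \in rest}) : val x \in ~: S i.
  by have := valP x; rewrite /= !inE; apply: contra => xS; apply/bigcupP; exists i.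
apply: subset_leq_card; apply/subsetP => _ /imsetP[x + ->].
rewrite !inE => /existsP[y]; rewrite color_rel_comp; last exact: val_inj.
move=> xy; have := restS x; rewrite inE => -> /=.
by apply/exists_inP; exists (val y).
Qed.

(* The extremal coloring: to a coloring of I without large 1-cores add x i
   vertices of each color i, all of whose edges to I receive color i. *)
Lemma core_unavoidable_of_pm r (p x : 'I_r -> nat) (I V : finType) :
  (forall i, 3 * x i < p i) -> #|V| <= #|I| + \sum_i x i ->
  pm_unavoidable p V -> core_unavoidable (fun i => p i - 3 * x i) I.
Proof.
move=> xp cV pm k ksym.
pose E : finType := {i : 'I_r & 'I_(x i)}.
pose k' (u v : I + E) := match u, v with
  | inl a, inl b => k a b
  | inl _, inr t | inr t, inl _ => tag t
  (* Between two added vertices the smaller of their colors is used, so that an edge of color [i] at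
     an added vertex always meets one of color [i]. *)
  | inr t, inr t' => if tag t <= tag t' then tag t else tag t'
  end.
have k'sym u v : k' u v = k' v u.
  case: u v => [a|t] [b|t'] //=.
  by case: (ltngtP (tag t) (tag t')) => // /val_inj.
have cE : #|{: I + E}| = #|I| + \sum_i x i.
  rewrite card_sum card_tagged sumnE big_map big_enum /=; congr (_ + _).
  by apply: eq_bigr => i _; rewrite card_ord.
rewrite -cE in cV.
have [i [P [P2 Pi uP pP]]] := pm_unavoidable_le cV pm k'sym.
pose X := [set u : I + E | if u is inr t then tag t == i else false].
have cX : #|X| <= x i.
  pose f (j : 'I_(x i)) : I + E := inr (Tagged (fun i => 'I_(x i)) j).
  have <- : #|[set: 'I_(x i)]| = x i by rewrite cardsT card_ord.
  apply: leq_trans (leq_imset_card f setT).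
  apply: subset_leq_card; apply/subsetP => -[a|[j t]]; rewrite inE //= => /eqP ej.
  by rewrite -ej in f *; apply/imsetP; exists t.
exists i; rewrite leq_subLR addnC.
apply: leq_trans pP (leq_trans (path_matching_size_le
  (K := inl @: color_support k i) (X := X) _ P2 Pi uP) _).
  move=> u v /andP[uv /eqP]; rewrite !inE.
  case: u v uv => [a|t] [b|t'] /= uv; last 3 first.
  - by move=> ->; rewrite eqxx.
  - by move=> ->; rewrite eqxx.
  - by case: ifP => _ ->; rewrite eqxx ?orbT.
  have ab : a != b by apply: contraNneq uv => ->.
  move=> kab; rewrite !imset_f ?inE //; apply/existsP; [exists a|exists b].
    by rewrite /color_rel eq_sym ab ksym kab eqxx.
  by rewrite /color_rel ab kab eqxx.
rewrite leq_add ?leq_mul // card_imset //; exact: inl_inj.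
Qed.

Theorem theorem3p3 (r : nat) (p : 'I_r -> nat)
    (hr : 2 <= r)
    (p_noninc : forall i j : 'I_r, i <= j -> p j <= p i)
    (p_ge2 : forall i : 'I_r, 2 <= p i) :
  R_PM p =
  \max_(x : {dffun forall i : 'I_r, 'I_(p i)} | [forall i, 3 * x i < p i])
    (R_1C (fun i => p i - 3 * x i) + \sum_(i < r) x i).
Proof.
pose i0 : 'I_r := Ordinal (ltnW hr).
have R1C (q : 'I_r -> nat) : 0 < R_1C q /\ core_unavoidable q 'I_(R_1C q).
  rewrite /R_1C; case: ex_minnP => m /andP[m0 /asboolP core] _.
  by split=> //; apply/(core_arrowP i0).
apply/eqP; rewrite eqn_leq; apply/andP; split; last first.
  apply/bigmax_leqP => x /forallP xp; rewrite leqNgt; apply/negP => ltR.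
  have {}ltR : R_PM p <= (R_1C (fun i => p i - 3 * x i)).-1 + \sum_i x i.
    have [R0 _] := R1C (fun i => p i - 3 * x i).
    by rewrite -ltnS -addSn prednK.
  have pm : pm_unavoidable p 'I_(R_PM p).
    by rewrite /R_PM; case: ex_minnP => m /andP[_ /asboolP arrow] _; apply/(PM_arrowP i0).
  move: ltR; rewrite /R_1C; case: ex_minnP => m /andP[m0 _] minm ltR.
  have core : core_unavoidable (fun i => p i - 3 * x i) 'I_m.-1.
    apply: (core_unavoidable_of_pm (V := 'I_(R_PM p))) => //.
    by rewrite !card_ord.
  (* Minimality of [m] is only among positive numbers, so [m.-1 = 0] is refuted directly: without
     vertices every support is empty, while [p i - 3 * x i] is positive. *)
  have [m1|m1] := posnP m.-1.
    have [//|i] := core (fun _ _ => i0).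
    have := max_card (color_support (fun _ _ : 'I_m.-1 => i0) i).
    by rewrite card_ord m1 leqn0 => /eqP->; rewrite leqn0 subn_eq0 leqNgt xp.
  have := minm m.-1; rewrite m1 /=.
  have -> : `[< core_arrow (fun i => p i - 3 * x i) m.-1 >].
    by apply/asboolP; apply/(core_arrowP i0).
  by move=> /(_ isT); rewrite leqNgt prednK // leqnn.
set M := (X in _ <= X).
(* The maximum ranges over functions with [x i < p i] to be finite; this bound follows from
   [3 * x i < p i], so every admissible [x] is covered. *)
have leM (x : 'I_r -> nat) : (forall i, 3 * x i < p i) ->
    R_1C (fun i => p i - 3 * x i) + \sum_i x i <= M.
  move=> xp; have xlt i : x i < p i by have := xp i; lia.
  pose y : {dffun forall i : 'I_r, 'I_(p i)} := [ffun i => Ordinal (xlt i)].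
  have yE i : y i = x i :> nat by rewrite ffunE.
  apply: leq_trans (leq_bigmax_cond
    (P := fun x : {dffun forall i : 'I_r, 'I_(p i)} =>
            [forall i, 3 * x i < p i]) y _); last first.
    by apply/forallP => i; rewrite yE.
  rewrite (eq_bigr (fun i => nat_of_ord (y i))) => [|i _]; last by rewrite yE.
  have -> // : (fun i => p i - 3 * x i) = (fun i => p i - 3 * y i).
  by apply: funext => i; rewrite yE.
rewrite {1}/R_PM; case: ex_minnP => m _; apply; apply/andP; split.
  (* The choice [x = 0] shows that [M] is positive. *)
  apply: leq_trans (leM (fun=> 0) _) => [|i]; last by rewrite muln0 ltnW.
  by rewrite addn_gt0 (R1C _).1.
apply/asboolP; apply/(PM_arrowP i0); apply: pm_unavoidable_of_core => x xp.
have [_ core] := R1C (fun i => p i - 3 * x i).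
by exists 'I_(R_1C (fun i => p i - 3 * x i)); rewrite // !card_ord leM.
Qed.
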